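(* Let $C_I>0$ be a constant, independent of $h$ and of the spring parameters, such that the inverse estimate $$\sum_{E\in\mathcal G_h}\big\{h_E^3\|V_n(v)\|_{0,E}^2+h_E\|M_{nn}(v)\|_{0,E}^2\big\}+\sum_{i=1}^mh_i^2\big(\llbracket M_{ns}(v)\rrbracket|_{c_i}\big)^2\le C_I\,a(v,v)\qquad\forall v\in V_h$$ holds. Suppose that $0<2\gamma<C_I^{-1}$. Then there is a constant $C>0$, independent of the mesh parameter $h$ and of the parameters $\varepsilon^v_i,\varepsilon^r_i,\varepsilon^c_i$, such that $$\mathcal A_h(v,v)\ge C\|v\|_h^2\qquad\forall v\in V_h .$$
   Context: **Plate model.** $\Omega\subset\mathbb R^2$ is a polygonal domain with corners $c_1,\dots,c_m$ numbered counterclockwise ($c_{m+1}=c_1$, $c_0=c_m$), and $\partial\Omega=\bigcup_{i=1}^m\Gamma_i$, where $\Gamma_i$ is the segment from $c_i$ to $c_{i+1}$. $E>0$ (Young's modulus), $d>0$ (thickness) and $-1<\nu<1$ (Poisson ratio) are constants. For a function $w$: $K(w)=-\nabla^2w$ (minus the Hessian), $M(w)=\frac{Ed^3}{12(1+\nu)}\big(K(w)+\frac{\nu}{1-\nu}\mathrm{tr}(K(w))I\big)$, $Q(w)=\mathrm{div}\,M(w)$ (row-wise divergence), and $a(w,v)=\int_\Omega M(w):K(v)\,dx$. With $n=(n_1,n_2)$ the outward unit normal and $s=(-n_2,n_1)$ the unit tangent: $Q_n(w)=Q(w)\cdot n$, $M_{nn}(w)=n\cdot M(w)n$, $M_{ns}(w)=s\cdot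 M(w)n$, and $V_n(w)=Q_n(w)+\partial M_{ns}(w)/\partial s$. At a corner, $\llbracket M_{ns}(w)\rrbracket|_{c_i}=\lim_{\epsilon\to0+}\big(M_{ns}(w)|_{c_i+\epsilon(c_{i+1}-c_i)}-M_{ns}(w)|_{c_i+\epsilon(c_{i-1}-c_i)}\big)$. **Data.** $\varepsilon^v_i,\varepsilon^r_i,\varepsilon^c_i>0$, $i=1,\dots,m$, are spring parameters. **Discretization.** $\mathcal C_h$ belongs to a (shape-)regular family of meshes of $\Omega$ into non-overlapping elements (triangles or rectangles), $h_K$ the diameter of $K$, $h=\max_Kh_K$; $\mathcal G_h$ is the set of boundary edges, $h_E$ the length of edge $E$, and $h_i=\max\{h_K:K\in\mathcal C_h,\ c_i\in K\}$. The finite element space is $V_h=\{v\in H^2(\Omega):v|_K\in V_K\ \forall K\in\mathcal C_h\}$, where $P_p(K)\subset V_K\subset P_l(K)$ for some $p,l$ ($P_k(K)$: polynomials of degree $\le k$). For $E\in\mathcal G_h$, $E\subset\Gamma_i$, write $\varepsilon^v_E=\varepsilon^v_i$, $\varepsilon^r_E=\varepsilon^r_i$. $(\cdot,\cdot)_E$ and $\|\cdot\|_{0,E}$ are the $L^2(E)$ inner product and norm. **Nitsche bilinear form.** For the stabilization parameter $\gamma>0$, $\mathcal A_h(w,v)=a(w,v)+b_h(w,v)+c_h(w,v)+d_h(w,v)$ with $$b_h(w,v)=\sum_{E\in\mathcal G_h}\frac1{\varepsilon^v_E+\gamma h_E^3}\big\{-\gamma h_E^3[(V_n(w),v)_E+(w,V_n(v))_E]-\gamma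 h_E^3\varepsilon^v_E(V_n(w),V_n(v))_E+(w,v)_E\big\},$$ $$c_h(w,v)=\sum_{E\in\mathcal G_h}\frac1{\varepsilon^r_E+\gamma h_E}\big\{\gamma h_E[(M_{nn}(w),\tfrac{\partial v}{\partial n})_E+(\tfrac{\partial w}{\partial n},M_{nn}(v))_E]-\gamma h_E\varepsilon^r_E(M_{nn}(w),M_{nn}(v))_E+(\tfrac{\partial w}{\partial n},\tfrac{\partial v}{\partial n})_E\big\},$$ $$d_h(w,v)=\sum_{i=1}^m\frac1{\varepsilon^c_i+\gamma h_i^2}\big\{-\gamma h_i^2\big(\llbracket M_{ns}(w)\rrbracket|_{c_i}v(c_i)+\llbracket M_{ns}(v)\rrbracket|_{c_i}w(c_i)\big)-\gamma h_i^2\varepsilon^c_i\llbracket M_{ns}(w)\rrbracket|_{c_i}\llbracket M_{ns}(v)\rrbracket|_{c_i}+w(c_i)v(c_i)\big\}.$$ **Norm.** $$\|w\|_h^2=a(w,w)+\sum_{E\in\mathcal G_h}\Big\{\frac1{\varepsilon^v_E+h_E^3}\|w\|_{0,E}^2+\frac1{\varepsilon^r_E+h_E}\Big\|\frac{\partial w}{\partial n}\Big\|_{0,E}^2\Big\}+\sum_{i=1}^m\frac1{\varepsilon^c_i+h_i^2}w(c_i)^2.$$ The constant $C$ may depend on $\gamma$ and $C_I$. *)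

(* Defs.v *)
From mathcomp Require Import all_boot all_order all_algebra.
From mathcomp Require Import all_classical all_reals all_analysis.
Set Implicit Arguments.
Unset Strict Implicit.
Unset Printing Implicit Defensive.
Import Order.TTheory GRing.Theory Num.Theory numFieldNormedType.Exports.
Local Open Scope classical_set_scope.
Local Open Scope ring_scope.

(* The library norm on R * R is the sup norm; it is used only for the topology
   and for differentiation.  Lengths and diameters are Euclidean. *)
Section Plane.
Context {R : realType}.
Implicit Types (x y a b : R * R) (A : set (R * R)).

Definition dotp x y : R := x.1 * y.1 + x.2 * y.2.
Definition cross x y : R := x.1 * y.2 - x.2 * y.1.
Definition elen x : R := Num.sqrt (dotp x x).

Definition coord x (i : 'I_2) : R := if i == ord0 then x.1 else x.2.
Definition basis (i : 'I_2) : R * R := if i == ord0 then (1, 0) else (0, 1).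

Definition onseg a b (t : R) : R * R := a + t *: (b - a).
Definition segment a b : set (R * R) := onseg a b @` `[0, 1].
Definition osegment a b : set (R * R) := onseg a b @` `]0, 1[.

Definition hull (s : seq (R * R)) : set (R * R) :=
  [set x | exists t : nat -> R,
     [/\ forall j, 0 <= t j, \sum_(j < size s) t j = 1
       & x = \sum_(j < size s) t j *: nth 0 s j]].

Definition diam A : R :=
  sup [set r | exists x y, [/\ A x, A y & r = elen (x - y)]].

(* diameter of the largest disc contained in A *)
Definition indiam A : R :=
  sup [set r | exists x rho,
         [/\ 0 <= rho, forall y, elen (y - x) <= rho -> A y & r = 2 * rho]].

Definition leb2 := (@lebesgue_measure R \x @lebesgue_measure R)%E.

(* (f, g)_E for the segment E from a to b: arc-length measure, parametrized
   over [0, 1]. *)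
Definition seg_inner a b (f g : R * R -> R) : R :=
  elen (b - a) *
  (\int[@lebesgue_measure R]_(t in `[0, 1])
     (f (onseg a b t) * g (onseg a b t)))%R.

(* P_k: polynomial functions of total degree at most k *)
Definition polyfun (k : nat) : set (R * R -> R) :=
  [set q | exists a : nat -> nat -> R, forall x,
     q x = \sum_(i < k.+1) \sum_(j < k.+1 | (i + j <= k)%N)
             a i j * x.1 ^+ i * x.2 ^+ j].

Definition partial (i : 'I_2) (f : R * R -> R) : R * R -> R :=
  'D_(basis i) f.
Definition partials (s : seq 'I_2) (f : R * R -> R) : R * R -> R :=
  foldr partial f s.

(* C^oo with compact support in A *)
Definition test_function A (phi : R * R -> R) : Prop :=
  (forall s x, differentiable (partials s phi) x) /\
  exists B : set (R * R),
    [/\ compact B, B `<=` A & forall x, ~ B x -> phi x = 0].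

Definition L2 A (f : R * R -> R) : Prop := f \_ A \in Lfun leb2 2%:E.

Definition weak_partials A (s : seq 'I_2) (f g : R * R -> R) : Prop :=
  forall phi, test_function A phi ->
    (\int[leb2]_(x in A) (f x * partials s phi x))%R =
    (-1) ^+ size s * (\int[leb2]_(x in A) (g x * phi x))%R.

Definition H2 A (f : R * R -> R) : Prop :=
  L2 A f /\
  forall s : seq 'I_2, (size s <= 2)%N ->
    exists g, L2 A g /\ weak_partials A s f g.

End Plane.

Record plate (R : realType) := Plate {
  ncorner : nat;
  domain : set (R * R);
  corner : 'I_ncorner -> R * R;
  young : R;
  thickness : R;
  poisson : R }.

Section PlateModel.
Context {R : realType} (P : plate R).
Implicit Types (i : 'I_(ncorner P)) (w v : R * R -> R) (x nu : R * R).

Let c := @corner R P.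

(* [ordS] and [ord_pred] are the cyclic successor and predecessor. *)
Definition side i : set (R * R) := segment (c i) (c (ordS i)).

Definition tangent i : R * R :=
  (elen (c (ordS i) - c i))^-1 *: (c (ordS i) - c i).

(* [polygon_left] below makes this the outward unit normal. *)
Definition normal i : R * R := ((tangent i).2, - (tangent i).1).

(* [rot90 n] is the tangent s = (-n_2, n_1). *)
Definition rot90 x : R * R := (- x.2, x.1).

Record polygonal_domain : Prop := {
  polygon_ncorner : (3 <= ncorner P)%N;
  polygon_open : open (domain P);
  polygon_connected : connected (domain P);
  polygon_bounded : bounded_set (domain P);
  polygon_corner : forall i,
    cross (c i - c (ord_pred i)) (c (ordS i) - c i) != 0;
  polygon_simple : forall i j x, i != j -> side i x -> side j x ->
    (j = ordS i /\ x = c j) \/ (i = ordS j /\ x = c i);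
  polygon_boundary : closure (domain P) `\` domain P = \bigcup_i side i;
  (* counterclockwise numbering: the domain lies to the left of each side *)
  polygon_left : forall i x, osegment (c i) (c (ordS i)) x ->
    exists2 delta : R, 0 < delta &
      forall t, 0 < t -> t < delta ->
        domain P (x - t *: normal i) /\
        ~ closure (domain P) (x + t *: normal i) }.

Record is_plate : Prop := {
  plate_domain : polygonal_domain;
  plate_young : 0 < young P;
  plate_thickness : 0 < thickness P;
  plate_poisson : -1 < poisson P < 1 }.

Definition curvature w x : 'M[R]_2 :=
  - \matrix_(i, j) partial i (partial j w) x.

Definition moment w x : 'M[R]_2 :=
  (young P * thickness P ^+ 3 / (12 * (1 + poisson P))) *:
  (curvature w x +
   (poisson P / (1 - poisson P) * \tr (curvature w x))%:M).

Definition shear w x (i : 'I_2) : R :=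
  \sum_(j < 2) partial j (fun y => moment w y i j) x.

Definition shear_n nu w x : R := \sum_(i < 2) shear w x i * coord nu i.

Definition moment_nn nu w x : R :=
  \sum_(i < 2) \sum_(j < 2) coord nu i * moment w x i j * coord nu j.

Definition moment_ns nu w x : R :=
  \sum_(i < 2) \sum_(j < 2)
    coord (rot90 nu) i * moment w x i j * coord nu j.

Definition kirchhoff nu w x : R :=
  shear_n nu w x + 'D_(rot90 nu) (moment_ns nu w) x.

(* For w, v in H^2 that are smooth inside each element, the second derivatives
   exist classically off the element boundaries, where they agree with the weak
   ones; the exceptional set is null. *)
Definition energy w v : R :=
  (\int[leb2]_(x in domain P)
     \sum_(i < 2) \sum_(j < 2) moment w x i j * curvature v x i j)%R.

End PlateModel.

(* An element is given by the cyclic list of its vertices and is the convex hull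
   of them; [locsp k] is the local space V_K, each function on K being
   represented by the polynomial function on the plane that extends it. *)
Record discretization (R : realType) := Discretization {
  nelt : nat;
  elt : 'I_nelt -> seq (R * R);
  locsp : 'I_nelt -> set (R * R -> R) }.

Section Discretization.
Context {R : realType}.
Implicit Types (s : seq (R * R)) (w v : R * R -> R).

Definition is_triangle s : Prop :=
  size s = 3%N /\ cross (nth 0 s 1 - nth 0 s 0) (nth 0 s 2 - nth 0 s 0) != 0.

Definition is_rectangle s : Prop :=
  [/\ size s = 4%N, nth 0 s 3 - nth 0 s 0 = nth 0 s 2 - nth 0 s 1,
      dotp (nth 0 s 1 - nth 0 s 0) (nth 0 s 3 - nth 0 s 0) = 0
    & cross (nth 0 s 1 - nth 0 s 0) (nth 0 s 3 - nth 0 s 0) != 0].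

Definition eorg s (e : nat) : R * R := nth 0 s e.
Definition eend s (e : nat) : R * R := nth 0 s (e.+1 %% size s).
Definition edge s (e : nat) : set (R * R) := segment (eorg s e) (eend s e).

Context (P : plate R) (D : discretization R).
Implicit Types (i : 'I_(ncorner P)) (k : 'I_(nelt D)).

Let K k : seq (R * R) := elt k.

Record is_mesh : Prop := {
  mesh_elt : forall k, is_triangle (K k) \/ is_rectangle (K k);
  mesh_cover : closure (domain P) = \bigcup_k hull (K k);
  mesh_disjoint : forall k k', k != k' ->
    interior (hull (K k)) `&` interior (hull (K k')) = set0;
  (* the boundary is a union of element edges *)
  mesh_boundary : forall i x, side i x ->
    exists k (e : 'I_(size (K k))),
      edge (K k) e `<=` side i /\ edge (K k) e x }.

Record is_local_spaces (p l : nat) : Prop := {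
  locsp_lower : forall k, polyfun p `<=` locsp k;
  locsp_upper : forall k, locsp k `<=` polyfun l;
  locsp_linear : forall k (a : R) q r,
    locsp k q -> locsp k r -> locsp k (fun x => a * q x + r x) }.

Definition fespace : set (R * R -> R) :=
  [set v | H2 (domain P) v /\
     forall k, exists2 q, locsp k q & forall x, hull (K k) x -> v x = q x].

(* The polynomial that coincides with v on K; it is unique since K has interior
   points.  It gives the traces on edges of K of derivatives of v|_K. *)
Definition piece k v : R * R -> R :=
  xget (fun=> 0)
    [set q | (exists l, polyfun l q) /\ forall x, hull (K k) x -> v x = q x].

(* Sum over the boundary edges E, presented as triples: E is the edge e of the
   element k and lies on side i.  A boundary edge belongs to exactly one element
   and, two consecutive sides never being aligned, to exactly one side. *)
Definition bd_sum
    (F : 'I_(ncorner P) -> forall k, 'I_(size (K k)) -> R) : R :=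
  \sum_i \sum_k \sum_(e < size (K k) | `[< edge (K k) e `<=` side i >]) F i k e.

Definition hE k (e : nat) : R := elen (eend (K k) e - eorg (K k) e).
Definition inner k (e : nat) f g : R :=
  seg_inner (eorg (K k) e) (eend (K k) e) f g.

Definition hcorner i : R :=
  \big[Num.max/0]_(k | `[< hull (K k) (corner i) >]) diam (hull (K k)).

(* traces on an edge of K lying on side i *)
Definition Vn i k v : R * R -> R := kirchhoff P (normal i) (piece k v).
Definition Mnn i k v : R * R -> R := moment_nn P (normal i) (piece k v).
Definition dn i k v : R * R -> R := 'D_(normal i) (piece k v).

(* M_ns(v) on side i, taken from the element with a boundary edge through x;
   this is unambiguous except at the end points of the boundary edges. *)
Definition Mns i v (x : R * R) : R :=
  if [pick k | `[< exists e : 'I_(size (K k)),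
                   edge (K k) e `<=` side i /\ edge (K k) e x >]] is Some k
  then moment_ns P (normal i) (piece k v) x else 0.

Definition jump_Mns i v : R :=
  let ci := corner i in
  let cnext := corner (ordS i) in
  let cprev := corner (ord_pred i) in
  lim ((Mns i v (ci + eps *: (cnext - ci)) -
        Mns (ord_pred i) v (ci + eps *: (cprev - ci))) @[eps --> 0^'+]).

Definition inverse_estimate (CI : R) : Prop :=
  forall v, fespace v ->
    bd_sum (fun i k e =>
      hE k e ^+ 3 * inner k e (Vn i k v) (Vn i k v)
      + hE k e * inner k e (Mnn i k v) (Mnn i k v))
    + \sum_i hcorner i ^+ 2 * jump_Mns i v ^+ 2
    <= CI * energy P v v.

Context (gamma : R) (epsv epsr epsc : 'I_(ncorner P) -> R).

Definition b_h w v : R :=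
  bd_sum (fun i k e =>
    let g := gamma * hE k e ^+ 3 in
    (epsv i + g)^-1 *
    (- g * (inner k e (Vn i k w) v + inner k e w (Vn i k v))
     - g * epsv i * inner k e (Vn i k w) (Vn i k v)
     + inner k e w v)).

Definition c_h w v : R :=
  bd_sum (fun i k e =>
    let g := gamma * hE k e in
    (epsr i + g)^-1 *
    (g * (inner k e (Mnn i k w) (dn i k v) + inner k e (dn i k w) (Mnn i k v))
     - g * epsr i * inner k e (Mnn i k w) (Mnn i k v)
     + inner k e (dn i k w) (dn i k v))).

Definition d_h w v : R :=
  \sum_i
    let g := gamma * hcorner i ^+ 2 in
    (epsc i + g)^-1 *
    (- g * (jump_Mns i w * v (corner i) + jump_Mns i v * w (corner i))
     - g * epsc i * jump_Mns i w * jump_Mns i v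
     + w (corner i) * v (corner i)).

Definition nitsche w v : R := energy P w v + b_h w v + c_h w v + d_h w v.

(* the square of the mesh-dependent norm *)
Definition sqnorm_h w : R :=
  energy P w w
  + bd_sum (fun i k e =>
      (epsv i + hE k e ^+ 3)^-1 * inner k e w w
      + (epsr i + hE k e)^-1 * inner k e (dn i k w) (dn i k w))
  + \sum_i (epsc i + hcorner i ^+ 2)^-1 * w (corner i) ^+ 2.

End Discretization.

Definition shape_regular (R : realType) (J : Type)
    (D : J -> discretization R) : Prop :=
  exists kappa : R, forall j (k : 'I_(nelt (D j))),
    diam (hull (elt k)) <= kappa * indiam (hull (elt k)).

(* Main.v *)
(* Weighted Young on each boundary edge: with g = gamma h_E^3, the mixed term
   2 g (V_n(v), v)_E is at most 1/2 ||v||_E^2 + 2 g^2 ||V_n(v)||_E^2.  Half of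
   the boundary term survives, and the total V_n contribution is at least
   -(g e + 2 g^2) / (e + g) ||V_n(v)||_E^2 >= -2 gamma h_E^3 ||V_n(v)||_E^2,
   uniformly in the spring parameter e.  The rotation and corner terms behave
   alike, so the inverse estimate bounds the total loss by
   2 gamma CI a(v, v) < a(v, v).  It also gives a(v, v) >= 0. *)
Require Import Defs.
From mathcomp Require Import all_boot all_order all_algebra.
From mathcomp Require Import all_classical all_reals all_analysis.
From mathcomp Require Import ring lra.
Import Order.TTheory GRing.Theory Num.Theory numFieldNormedType.Exports.
Local Open Scope classical_set_scope.
Local Open Scope ring_scope.

(* An inductive form of [polyfun] without coefficients or degrees: stability under
   differentiation makes every trace continuous on edges, hence integrable. *)
Inductive plane_poly {R : realType} : (R * R -> R) -> Prop :=
| plane_poly_cst c : plane_poly (fun=> c)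
| plane_poly_fst : plane_poly fst
| plane_poly_snd : plane_poly snd
| plane_polyD {f g} :
    plane_poly f -> plane_poly g -> plane_poly (fun x => f x + g x)
| plane_polyM {f g} :
    plane_poly f -> plane_poly g -> plane_poly (fun x => f x * g x).

(** * Polynomial functions on the plane: closure properties and differentiation *)

Section PlanePoly.
Context {R : realType}.
Implicit Types (f g : R * R -> R) (v x : R * R).

Lemma plane_polyZ c {f} : plane_poly f -> plane_poly (fun x => c * f x).
Proof. by move=> pf; apply: plane_polyM => //; exact: plane_poly_cst. Qed.

Lemma plane_polyN {f} : plane_poly f -> plane_poly (fun x => - f x).
Proof.
move=> /(plane_polyZ (-1)) pf.
by rewrite (_ : (fun x => - f x) = fun x => -1 * f x)//; apply/funext => x; ring.
Qed.

Lemma plane_polyX n {f} : plane_poly f -> plane_poly (fun x => f x ^+ n).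
Proof.
move=> pf; elim: n => [|n IHn]; first exact: plane_poly_cst.
rewrite (_ : (fun x => _) = fun x => f x * f x ^+ n); first exact: plane_polyM.
by apply/funext => x; rewrite exprS.
Qed.

Lemma plane_poly_sum {I : Type} (r : seq I) (p : pred I) {F : I -> R * R -> R} :
  (forall i, plane_poly (F i)) -> plane_poly (fun x => \sum_(i <- r | p i) F i x).
Proof.
move=> pF; elim: r => [|i r IHr].
  rewrite (_ : (fun x => _) = fun=> 0); first exact: plane_poly_cst.
  by apply/funext => x; rewrite big_nil.
rewrite (_ : (fun x => _) = fun x =>
    (if p i then F i x else 0) + \sum_(j <- r | p j) F j x); last first.
  by apply/funext => x; rewrite big_cons; case: ifP => // _; rewrite add0r.
by apply: plane_polyD => //; case: (p i) => //; exact: plane_poly_cst.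
Qed.

Lemma polyfun_plane_poly {k f} : polyfun k f -> plane_poly f.
Proof.
move=> [a fE]; rewrite (funext fE).
apply: plane_poly_sum => i; apply: plane_poly_sum => j.
apply: plane_polyM; last by apply: plane_polyX; exact: plane_poly_snd.
by apply: plane_polyZ; apply: plane_polyX; exact: plane_poly_fst.
Qed.

Lemma plane_poly_differentiable {f} x : plane_poly f -> differentiable f x.
Proof.
elim=> {f} [c|||f g _ df _ dg|f g _ df _ dg].
- exact: differentiable_cst.
- by apply: linear_differentiable => y; exact: cvg_fst.
- by apply: linear_differentiable => y; exact: cvg_snd.
- exact: differentiableD.
- exact: differentiableM.
Qed.

Lemma plane_poly_derive {f} v : plane_poly f -> plane_poly ('D_v f).
Proof.
have der h y : plane_poly h -> derivable h y v.
  by move=> ph; apply: diff_derivable; exact: plane_poly_differentiable.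
elim=> {f} [c|||f g pf pDf pg pDg|f g pf pDf pg pDg].
- rewrite (_ : 'D_v _ = fun=> 0); first exact: plane_poly_cst.
  by apply/funext => x; rewrite derive_cst.
(* A coordinate function is linear, hence its own differential, so its derivative along [v] is the
   constant coordinate of [v]. *)
- rewrite (_ : 'D_v _ = fun=> v.1); first exact: plane_poly_cst.
  apply/funext => x; rewrite deriveE ?diff_lin//; first by move=> y; exact: cvg_fst.
  exact: plane_poly_differentiable plane_poly_fst.
- rewrite (_ : 'D_v _ = fun=> v.2); first exact: plane_poly_cst.
  apply/funext => x; rewrite deriveE ?diff_lin//; first by move=> y; exact: cvg_snd.
  exact: plane_poly_differentiable plane_poly_snd.
- rewrite (_ : 'D_v _ = fun x => 'D_v f x + 'D_v g x); first exact: plane_polyD.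
  by apply/funext => x; apply: deriveD; exact: der.
- rewrite (_ : 'D_v _ = fun x => f x * 'D_v g x + g x * 'D_v f x).
    by apply: plane_polyD; exact: plane_polyM.
  by apply/funext => x; apply: deriveM; exact: der.
Qed.

End PlanePoly.

(** * Plate operators applied to polynomial functions *)

Section Operators.
Context {R : realType} (P : plate R) {w : R * R -> R} (nu : R * R)
  (pw : plane_poly w).

Lemma plane_poly_curvature i j : plane_poly (fun x => curvature w x i j).
Proof.
rewrite (_ : (fun x => _) = fun x => - partial i (partial j w) x).
  by apply: plane_polyN; do 2!apply: plane_poly_derive.
by apply/funext => x; rewrite !mxE.
Qed.

Lemma plane_poly_moment i j : plane_poly (fun x => moment P w x i j).
Proof.
rewrite (_ : (fun x => _) = fun x =>
  young P * thickness P ^+ 3 / (12 * (1 + poisson P)) *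
  (curvature w x i j + (i == j)%:R * (poisson P / (1 - poisson P) *
     \sum_k curvature w x k k))); last first.
  by apply/funext => x; rewrite mxE mxE [_%:M _ _]mxE [(i == j)%:R * _]mulr_natl.
apply: plane_polyZ; apply: plane_polyD; first exact: plane_poly_curvature.
do 2!apply: plane_polyZ; apply: plane_poly_sum => k.
exact: plane_poly_curvature.
Qed.

(** General coefficients let one statement serve both for $M_{ns}$, inside the Kirchhoff shear, and
    for $M_{nn}$. *)
Lemma plane_poly_moment_form (a b : 'I_2 -> R) :
  plane_poly (fun x => \sum_(i < 2) \sum_(j < 2) a i * moment P w x i j * b j).
Proof.
apply: plane_poly_sum => i; apply: plane_poly_sum => j.
apply: plane_polyM; last exact: plane_poly_cst.
by apply: plane_polyZ; exact: plane_poly_moment.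
Qed.

Lemma plane_poly_kirchhoff : plane_poly (kirchhoff P nu w).
Proof.
apply: plane_polyD; last first.
  by apply: plane_poly_derive; exact: plane_poly_moment_form.
apply: plane_poly_sum => i; apply: plane_polyM; last exact: plane_poly_cst.
apply: plane_poly_sum => j; apply: plane_poly_derive.
exact: plane_poly_moment.
Qed.

End Operators.

(** * The $L^2$ product on a segment *)

Section SegmentProduct.
Context {R : realType} (a b : R * R).
Implicit Types f g h : R * R -> R.

Lemma seg_innerC f g : seg_inner a b f g = seg_inner a b g f.
Proof.
by congr (_ * _); apply: eq_Rintegral => t _; rewrite mulrC.
Qed.

Lemma seg_inner_ge0 f : 0 <= seg_inner a b f f.
Proof.
apply: mulr_ge0; first exact: sqrtr_ge0.
by apply: Rintegral_ge0 => t _; rewrite -expr2 sqr_ge0.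
Qed.

Lemma eq_seg_inner {f f' g g'} :
  (forall x, segment a b x -> f x = f' x) ->
  (forall x, segment a b x -> g x = g' x) ->
  seg_inner a b f g = seg_inner a b f' g'.
Proof.
move=> eqf eqg; congr (_ * _); apply: eq_Rintegral => t /set_mem t01.
by rewrite eqf ?eqg//; exists t.
Qed.

Lemma continuous_onseg : continuous (onseg a b).
Proof.
by move=> t; apply: cvgD; [exact: cvg_cst | apply: cvgZr_tmp; exact: cvg_id].
Qed.

Lemma onseg_integrable {f} : plane_poly f ->
  (@lebesgue_measure R).-integrable `[0, 1] (EFin \o (fun t => f (onseg a b t))).
Proof.
move=> pf; apply: continuous_compact_integrable; first exact: segment_compact.
apply: continuous_subspaceT => t; apply: continuous_comp.
  exact: continuous_onseg.
by apply: differentiable_continuous; exact: plane_poly_differentiable.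
Qed.

(** The expression is the product of [g + s f] with itself; polynomiality gives the integrability
    needed to split the integral. The weight [s] stays free, to be fixed in the Young step. *)
Lemma seg_inner_expand_ge0 (s : R) {f g} : plane_poly f -> plane_poly g ->
  0 <= seg_inner a b g g + 2 * s * seg_inner a b f g + s ^+ 2 * seg_inner a b f f.
Proof.
move=> pf pg.
have int h1 h2 : plane_poly h1 -> plane_poly h2 ->
    (@lebesgue_measure R).-integrable `[0, 1]
      (EFin \o (fun t => h1 (onseg a b t) * h2 (onseg a b t))).
  by move=> p1 p2; exact (onseg_integrable (plane_polyM p1 p2)).
suff <- : seg_inner a b (fun x => g x + s * f x) (fun x => g x + s * f x) =
  seg_inner a b g g + 2 * s * seg_inner a b f g + s ^+ 2 * seg_inner a b f f.
  exact: seg_inner_ge0.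
have psf := plane_polyZ s pf.
have pgf := plane_polyZ (2 * s) pf.
rewrite /seg_inner.
under eq_Rintegral => t _.
  rewrite (_ : _ * _ = g (onseg a b t) * g (onseg a b t) +
    (2 * s * (f (onseg a b t) * g (onseg a b t)) +
     s ^+ 2 * (f (onseg a b t) * f (onseg a b t)))); last by ring.
  over.
have m01 : measurable (`[0, 1] : set R) by exact: measurable_itv.
have intZ c h1 h2 : plane_poly h1 -> plane_poly h2 ->
    (@lebesgue_measure R).-integrable `[0, 1]
      (EFin \o (fun t => c * (h1 (onseg a b t) * h2 (onseg a b t)))).
  move=> p1 p2.
  exact: (onseg_integrable (plane_polyZ c (plane_polyM p1 p2))).
rewrite RintegralD//; last 2 first.
- exact: int.
- exact: (onseg_integrable (plane_polyD (plane_polyZ (2 * s) (plane_polyM pf pg))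
    (plane_polyZ (s ^+ 2) (plane_polyM pf pf)))).
rewrite RintegralD ?RintegralZl//; [ring|exact: int..|exact: intZ|exact: intZ].
Qed.

End SegmentProduct.

(** * Element edges, polynomial pieces and boundary sums *)

Section Mesh.
Context {R : realType} {P : plate R} {D : discretization R}.
Implicit Types (k : 'I_(nelt D)) (v : R * R -> R).

(** The point at parameter [t] has barycentric weights [1 - t] and [t] at the two end vertices of
    the edge and 0 elsewhere. *)
Lemma edge_hull (s : seq (R * R)) (e : 'I_(size s)) : edge s e `<=` hull s.
Proof.
move=> _ [t + <-]; rewrite /= in_itv/= => /andP[t0 t1].
have ne : (e.+1 %% size s < size s)%N.
  by rewrite ltn_mod; case: (size s) e => [[]|].
pose e' := Ordinal ne.
(* Stated over any module, so that it evaluates both the sum of the weights (in [R^o]) and the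
   combination of the vertices. *)
have pick (V : lmodType R) (x : nat -> V) (a : 'I_(size s)) (c : R) :
    \sum_(j < size s) (c * (j == a :> nat)%:R) *: x j = c *: x a.
  rewrite (bigD1 a)//= eqxx mulr1 big1 ?addr0// => j.
  by rewrite -val_eqE/= => /negPf ->; rewrite mulr0 scale0r.
exists (fun j => (1 - t) * (j == e :> nat)%:R + t * (j == e' :> nat)%:R); split.
- by move=> j; rewrite addr_ge0// mulr_ge0// subr_ge0.
- transitivity (((1 - t) *: 1 + t *: 1) : R^o); last by rewrite -scalerDl subrK scale1r.
  rewrite -(pick R^o (fun=> 1) e) -(pick R^o (fun=> 1) e') -big_split/=.
  by apply: eq_bigr => j _; rewrite -scalerDl [RHS]mulr1.
- under eq_bigr do rewrite scalerDl.
  rewrite big_split/= (pick _ _ e) (pick _ _ e') /onseg /eorg /eend.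
  by rewrite scalerBl scale1r scalerBr addrAC addrA.
Qed.

(** The inclusion $V_K\subset P_l(K)$ provides a polynomial that agrees with [v] on $K$, so the
    choice in [piece] never falls back on its default. *)
Lemma pieceP {p l : nat} k {v} : is_local_spaces D p l -> fespace P D v ->
  plane_poly (piece k v) /\ (forall x, hull (elt k) x -> v x = piece k v x).
Proof.
move=> locD [_ /(_ k)[q Kq vq]].
rewrite /piece; case: xgetP => [q' -> [[l' pq'] vq']|/(_ q)[]].
  by split => //; exact: polyfun_plane_poly pq'.
by split => //; exists l; exact: (@locsp_upper _ _ _ _ locD k q Kq).
Qed.

(** Edge integrals see [v] only on $K$, so it may be replaced by a function that is polynomial on
    the whole plane. *)
Lemma inner_edgeE {p l : nat} k (e : 'I_(size (elt k))) (f : R * R -> R) {v} :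
  is_local_spaces D p l -> fespace P D v ->
  inner k e f v = inner k e f (piece k v) /\
  inner k e v v = inner k e (piece k v) (piece k v).
Proof.
move=> locD Vv; have [_ vE] := pieceP k locD Vv.
by split; apply: eq_seg_inner => // x /edge_hull; exact: vE.
Qed.

Implicit Types F G : 'I_(ncorner P) -> forall k, 'I_(size (elt k)) -> R.

Lemma bd_sumD F G :
  bd_sum (fun i k e => F i k e + G i k e) = bd_sum F + bd_sum G.
Proof.
rewrite /bd_sum -big_split; apply: eq_bigr => i _ /=.
by rewrite -big_split; apply: eq_bigr => k _ /=; rewrite -big_split.
Qed.

Lemma bd_sumZ c F : bd_sum (fun i k e => c * F i k e) = c * bd_sum F.
Proof.
rewrite /bd_sum mulr_sumr; apply: eq_bigr => i _.
by rewrite mulr_sumr; apply: eq_bigr => k _; rewrite mulr_sumr.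
Qed.

Lemma ler_bd_sum F G :
  (forall i k e, F i k e <= G i k e) -> bd_sum F <= bd_sum G.
Proof. by move=> FG; do 3!apply: ler_sum => ? _. Qed.

End Mesh.

(** * The termwise lower bound and coercivity *)

(* The hypothesis on X, Y, Z is needed only at s = - 2 gamma h, the weight that
   leaves half of Y and costs 2 gamma h X. *)
Lemma nitsche_term_ge {R : realFieldType} {C gamma e h X Y Z : R} :
  0 < gamma -> 0 <= C <= 1 / 2 -> C * gamma <= 1 / 2 -> 0 < e -> 0 <= h ->
  0 <= X -> 0 <= Y -> (forall s, 0 <= Y + 2 * s * Z + s ^+ 2 * X) ->
  C * ((e + h)^-1 * Y) - 2 * gamma * (h * X) <=
  (e + gamma * h)^-1 *
    (- (gamma * h) * (Z + Z) - gamma * h * e * X + Y).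
Proof.
move=> g0 /andP[C0 C1] Cg e0 h0 X0 Y0 /(_ (- 2 * (gamma * h))) YZ.
have gh0 : 0 <= gamma * h by rewrite mulr_ge0// ltW.
have egh0 : 0 < e + gamma * h by rewrite ltr_pwDl.
have eh0 : 0 < e + h by rewrite ltr_pwDl.
(* The two bounds on [C] give $C(e+\gamma h)\le(e+h)/2$, which converts the weight of the norm into
   that of the form. *)
have CY : C * ((e + h)^-1 * Y) * (e + gamma * h) <= Y / 2.
  rewrite (_ : _ * _ = C * (e + gamma * h) / (e + h) * Y); last by ring.
  rewrite mulrC ler_wpM2l// ler_pdivrMr//.
  have : C * e <= 1 / 2 * e by rewrite ler_wpM2r// ltW.
  have : C * gamma * h <= 1 / 2 * h by rewrite ler_wpM2r.
  lra.
rewrite [leRHS]mulrC ler_pdivlMr// mulrBl.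
(* After [CY] and half of [YZ], this product is exactly the remaining slack. *)
have ghX : 0 <= gamma * h * (e * X) by rewrite !mulr_ge0// ltW.
nra.
Qed.

Theorem theorem2 (R : realType) (P : plate R) (J : Type)
    (D : J -> discretization R) (p l : nat) (CI gamma : R) :
  is_plate P ->
  (forall j, is_mesh P (D j)) ->
  shape_regular D ->
  (forall j, is_local_spaces (D j) p l) ->
  0 < CI ->
  (forall j, inverse_estimate P (D j) CI) ->
  0 < 2 * gamma < CI^-1 ->
  exists C : R, 0 < C /\
    forall (j : J) (epsv epsr epsc : 'I_(ncorner P) -> R),
      (forall i, 0 < epsv i) ->
      (forall i, 0 < epsr i) ->
      (forall i, 0 < epsc i) ->
      forall v, fespace P (D j) v ->
        C * sqnorm_h (D j) epsv epsr epsc v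
        <= nitsche (D j) gamma epsv epsr epsc v v.
Proof.
move=> _ _ _ locD CI0 invD /andP[gamma2 gammaCI].
have g0 : 0 < gamma by lra.
have d0 : 0 < 1 - 2 * gamma * CI.
  by rewrite subr_gt0 -ltr_pdivlMr// div1r.
(* The first entry is the share of the energy left after the losses; the other two are the bounds on
   [C] required by [nitsche_term_ge]. *)
pose C := Num.min (1 - 2 * gamma * CI) (Num.min (1 / 2) (1 / 2 / gamma)).
have C0 : 0 < C by rewrite !lt_min d0 !divr_gt0.
have Cd : C <= 1 - 2 * gamma * CI by rewrite ge_min lexx.
have C2 : 0 <= C <= 1 / 2 by rewrite (ltW C0) !ge_min lexx orbT.
have Cg : C * gamma <= 1 / 2 by rewrite -ler_pdivlMr// !ge_min lexx !orbT.
exists C; split => // j epsv epsr epsc ev0 er0 ec0 v Vv.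
have := invD j v Vv.
set I1 := bd_sum _; set I2 := \sum_i _ => inv.
have hE0 k e : 0 <= hE (D := D j) k e by exact: sqrtr_ge0.
have I0 : 0 <= I1 + I2.
  apply: addr_ge0; do ?[apply: sumr_ge0 => ? _]; last first.
    by rewrite mulr_ge0// sqr_ge0.
  by rewrite addr_ge0// mulr_ge0 ?seg_inner_ge0// exprn_ge0.
have a0 : 0 <= energy P v v by rewrite -(pmulr_rge0 _ CI0) (le_trans I0).
rewrite /sqnorm_h /nitsche.
set N1 := bd_sum _; set N2 := \sum_i _.
have bcN : C * N1 - 2 * gamma * I1 <=
    b_h (D j) gamma epsv v v + c_h (D j) gamma epsr v v.
  rewrite -mulNr -!bd_sumZ -!bd_sumD; apply: ler_bd_sum => i k e.
  have [pq _] := pieceP k (locD j) Vv.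
  set h := hE k e.
  have pV := plane_poly_kirchhoff P (normal i) pq.
  have pM := plane_poly_moment_form P pq
    (Defs.coord (normal i)) (Defs.coord (normal i)).
  have pN := plane_poly_derive (normal i) pq.
  have [VvE vvE] := inner_edgeE k e (Vn i k v) (locD j) Vv.
  have h0 : 0 <= h := hE0 k e.
  have inner_ge0 f : 0 <= inner k e f f by exact: seg_inner_ge0.
  have hv s : 0 <= inner k e v v + 2 * s * inner k e (Vn i k v) v +
      s ^+ 2 * inner k e (Vn i k v) (Vn i k v).
    by rewrite VvE vvE; exact: seg_inner_expand_ge0.
  (* The mixed terms of [c_h] have the opposite sign to those of [b_h], so $Z=-(M_{nn}(v),\partial
     v/\partial n)_E$, which is the expansion at [- s]. *)
  have hn s : 0 <= inner k e (dn i k v) (dn i k v) +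
      2 * s * - inner k e (Mnn i k v) (dn i k v) +
      s ^+ 2 * inner k e (Mnn i k v) (Mnn i k v).
    rewrite mulrN -mulNr -mulrN -sqrrN; exact: seg_inner_expand_ge0.
  have tv := nitsche_term_ge g0 C2 Cg (ev0 i) (exprn_ge0 3 h0) (inner_ge0 _)
    (inner_ge0 _) hv.
  have tn := nitsche_term_ge g0 C2 Cg (er0 i) h0 (inner_ge0 _) (inner_ge0 _) hn.
  apply: (le_trans (le_trans _ (lerD tv tn))).
    by rewrite le_eqVlt; apply/orP; left; apply/eqP; rewrite /= -/h; ring.
  rewrite /= -/h [inner k e v (Vn i k v)]seg_innerC.
  rewrite [inner k e (dn i k v) (Mnn i k v)]seg_innerC.
  by rewrite le_eqVlt; apply/orP; left; apply/eqP; rewrite /inner; ring.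
have dN : C * N2 - 2 * gamma * I2 <= d_h (D j) gamma epsc v v.
  rewrite !mulr_sumr -sumrB; apply: ler_sum => i _ /=.
  set x := v _; set m := jump_Mns _ _ _; set h := hcorner _ _.
  (* At a corner only two real numbers are involved, and the quadratic is the square of
     [x + s m]. *)
  have mx s : 0 <= x ^+ 2 + 2 * s * (m * x) + s ^+ 2 * m ^+ 2.
    by rewrite (_ : _ + _ = (x + s * m) ^+ 2) ?sqr_ge0//; ring.
  apply: le_trans (nitsche_term_ge g0 C2 Cg (ec0 i) (sqr_ge0 h) (sqr_ge0 _)
    (sqr_ge0 _) mx) _.
  by rewrite le_eqVlt; apply/orP; left; apply/eqP; ring.
(* The inverse estimate charges all losses to the energy; what remains of it still dominates [C]
   times the energy. *)
have : 2 * gamma * (I1 + I2) <= 2 * gamma * (CI * energy P v v).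
  by rewrite ler_wpM2l// ltW.
have : C * energy P v v <= (1 - 2 * gamma * CI) * energy P v v.
  by rewrite ler_wpM2r.
move: bcN dN; lra.
Qed.
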